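(* Let $A$ be a real affine space of finite dimension $n$ with linear hull $\widehat A=(\mathrm{Aff}(A))^*$. The map $\Theta: S^2\mathrm{Aff}(A)=S^2\widehat A^{*}\to\mathrm{Quad}(A)$ sending a symmetric bilinear form $\widehat g$ on $\widehat A$ to the quadratic function $\delta(P)=\frac12\widehat g(z_P,z_P)$ is a linear isomorphism. The following two rows are exact sequences of linear maps: $$0\to\mathbb R\hookrightarrow\mathrm{Quad}(A)\xrightarrow{\ \nabla\ }\mathrm{Aff}^S(A,\vec A^* )\to0,$$ $$0\to\mathrm{Aff}(A)\xrightarrow{\ \mathrm{Id}\otimes u+u\otimes\mathrm{Id}\ }S^2\mathrm{Aff}(A)\xrightarrow{\ \mathrm d\otimes\mathrm d\ }S^2\vec A^*\to0,$$ and the diagram formed by them together with the inclusions $\mathbb R\hookrightarrow\mathrm{Aff}(A)\hookrightarrow\mathrm{Quad}(A)$, the isomorphism $\Theta$, the map $\mathrm{Hess}:\mathrm{Quad}(A)\to S^2\vec A^*$ and the map $\mathrm d:\mathrm{Aff}^S(A,\vec A^* )\to S^2\vec A^*$, $\omega\mapsto\vec\omega$, is commutative; that is: the inclusion $\mathbb R\hookrightarrow\mathrm{Quad}(A)$ is the composite $\mathbb R\hookrightarrow\mathrm{Aff}(A)\hookrightarrow\mathrm{Quad}(A)$; $\Theta(f\otimes u+u\otimes f)=f$ for all $f\in\mathrm{Aff}(A)$; $\mathrm{Hess}=\mathrm d\circ\nabla$; and $\mathrm{Hess}\circ\Theta=\mathrm d\otimes\mathrm d$. Moreover, given an affine referential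 $(R_0,\dots,R_n)$ of $A$, the isomorphism $\Theta$ relates quadratic functions $\delta$, symmetric bilinear forms $\widehat g$ and symmetric $(n+1)\times(n+1)$ real matrices $G$ (the Gram matrix of $\widehat g$ in the basis $z_{R_0},\dots,z_{R_n}$ of $\widehat A$) by the rules $$\delta(P)=\tfrac12\widehat g(z_P,z_P)=\tfrac12p^tGp,$$ $$\widehat g(z_P,z_Q)=4\delta\left(\tfrac{P+Q}2\right)-\delta(P)-\delta(Q)=p^tGq,$$ $$G_{ij}=\widehat g(z_{R_i},z_{R_j})=4\delta\left(\tfrac{R_i+R_j}2\right)-\delta(R_i)-\delta(R_j),$$ where $p,q$ are the barycentric coordinate column vectors of $P,Q\in A$ in the referential.
   Context: All spaces are real and finite-dimensional. For an affine space $A$ with director space $\vec A$: $\mathrm{Aff}(A)$ is the vector space of affine functions $A\to\mathbb R$, $u$ the constant function $1$; $\mathbb R=\langle u\rangle$; $\vec A^*=\mathrm{Aff}(A)/\mathbb R$ is the dual of $\vec A$, and $\mathrm d:\mathrm{Aff}(A)\to\vec A^*$ the projection (linear part). The linear hull is $\widehat A=(\mathrm{Aff}(A))^*$, so $\widehat A^*=\mathrm{Aff}(A)$; $z_P\in\widehat A$ is evaluation at $P$: $\langle z_P,f\rangle=f(P)$. An affine referential is a sequence of $n+1$ affinely independent points $R_0,\dots,R_n$ of $A$ ($n=\dim A$); then $z_{R_0},\dots,z_{R_n}$ is a basis of $\widehat A$, and the barycentric coordinate vector of $P=\sum p_iR_i$ ($\sum p_i=1$) is $p=[p_0\dots p_n]^t$.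 For a vector space $V$, $S^2V^*$ denotes the space of symmetric bilinear forms on $V$; for $f,h\in V^*$, $(f\otimes h)(x,y)=f(x)h(y)$. The map $\mathrm d\otimes \mathrm d$ sends $f\otimes h+h\otimes f$ to $\mathrm df\otimes\mathrm dh+\mathrm dh\otimes\mathrm df$ (restriction of bilinear forms to $\vec A=\{z\in\widehat A:\langle z,u\rangle=0\}$). A function $\delta:A\to\mathbb R$ is quadratic if $\delta(\alpha P+\beta Q)=\alpha(\alpha-\beta)\delta(P)+\beta(\beta-\alpha)\delta(Q)+4\alpha\beta\,\delta(\frac{P+Q}2)$ for all $P,Q\in A$ and $\alpha+\beta=1$; these form the vector space $\mathrm{Quad}(A)$. With $\delta^h_P(Q)=\frac12(\delta(Q)+\delta(2P-Q))-\delta(P)$, the function $\delta-\delta^h_P$ is affine and $\nabla_P\delta=\mathrm d(\delta-\delta^h_P)\in\vec A^*$; $\nabla\delta:P\mapsto\nabla_P\delta$ is an affine map $A\to\vec A^*$. For an affine map $\omega:A\to\vec A^*$ its principal component is the bilinear form $\vec\omega$ on $\vec A$ given by $\langle\vec x,\vec\omega(\vec y)\rangle=\langle\omega_{P+\vec y},\vec x\rangle-\langle\omega_P,\vec x\rangle$ (any $P$). $\mathrm{Aff}^S(A,\vec A^* )$ is the space of affine maps $\omega:A\to\vec A^*$ whose principal component is symmetric. $\mathrm{Hess}\,\delta$ is the principal component of $\nabla\delta$. *)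

(* Defs.v *)
From HB Require Import structures.
From mathcomp Require Import all_boot all_order all_algebra.
From mathcomp Require Import ring lra.
From mathcomp Require Import boolp classical_sets functions reals.

Set Implicit Arguments.
Unset Strict Implicit.
Unset Printing Implicit Defensive.

Import Order.TTheory GRing.Theory Num.Theory.
Local Open Scope ring_scope.

(* [shift P x] is P + x and [vdiff Q P] is the vector Q - P. *)
HB.mixin Record isAffineSpace (R : realType) (V : vectType R) (A : Type) := {
  affine_inhabited : inhabited A;
  shift : A -> V -> A;
  vdiff : A -> A -> V;
  shiftD : forall P x y, shift (shift P x) y = shift P (x + y);
  shift_vdiff : forall P Q, shift P (vdiff Q P) = Q;
  vdiff_shift : forall P x, vdiff (shift P x) P = x
}.

#[short(type="affineType")]
HB.structure Definition AffineSpace (R : realType) (V : vectType R) :=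
  {A of isAffineSpace R V A}.

Section AffineCombinations.
Variables (R : realType) (V : vectType R) (A : affineType V).
Implicit Types (P Q : A) (x y : V).

Lemma shift0 P : shift P (0 : V) = P.
Proof.
by rewrite -{1}(shift_vdiff P P) shiftD addr0 shift_vdiff.
Qed.

(* The affine combination a P + b Q, where a = 1 - b. *)
Definition acomb P Q (b : R) : A := shift P (b *: vdiff Q P).

Definition midpoint P Q : A := acomb P Q 2^-1.

Definition origin : A := inhabited_witness affine_inhabited.

Lemma acomb_shift P x y b :
  acomb (shift P x) (shift P y) b = shift P (x + b *: (y - x)).
Proof.
rewrite /acomb shiftD; congr (shift _ (_ + _ *: _)).
have -> : shift P y = shift (shift P x) (y - x) by rewrite shiftD addrC subrK.
by rewrite vdiff_shift.
Qed.

Lemma acomb_shiftr P x b : acomb P (shift P x) b = shift P (b *: x).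
Proof. by rewrite /acomb vdiff_shift. Qed.

(* The point \sum_i p_i Rp_i for \sum_i p_i = 1, written from the origin Rp_0
   (no other origin would change it). *)
Definition bary n (Rp : 'I_n.+1 -> A) (p : 'cV[R]_n.+1) : A :=
  shift (Rp ord0) (\sum_i p i 0 *: vdiff (Rp i) (Rp ord0)).

Definition bary_coords n (Rp : 'I_n.+1 -> A) P (p : 'cV[R]_n.+1) : Prop :=
  \sum_i p i 0 = 1 /\ P = bary Rp p.

Definition affinely_independent n (Rp : 'I_n.+1 -> A) : bool :=
  free [tuple vdiff (Rp (lift ord0 i)) (Rp ord0) | i < n].

Lemma vdiffxx P : vdiff P P = 0.
Proof. by rewrite -{1}(shift0 P) vdiff_shift. Qed.

Lemma bary_coords_exists n (Rp : 'I_n.+1 -> A) P :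
  \dim {:V} = n -> affinely_independent Rp -> exists! p, bary_coords Rp P p.
Proof.
move=> dimV; rewrite /affinely_independent.
set X := [tuple _ | i < n] => freeX.
have XE (i : 'I_n) : X`_i = vdiff (Rp (lift ord0 i)) (Rp ord0).
  by rewrite -tnth_nth tnth_mktuple.
have baryE (p : 'cV[R]_n.+1) :
    bary Rp p = shift (Rp ord0) (\sum_(i < n) p (lift ord0 i) 0 *: X`_i).
  rewrite /bary big_ord_recl vdiffxx scaler0 add0r; congr (shift _ _).
  by apply: eq_bigr => i _; rewrite XE.
have basX : basis_of {:V} X by rewrite basisEfree freeX subvf dimV size_tuple /=.
pose c i := coord X i (vdiff P (Rp ord0)).
pose p : 'cV[R]_n.+1 :=
  \col_i if unlift ord0 i is Some j then c j else 1 - \sum_j c j.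
have pl j : p (lift ord0 j) 0 = c j by rewrite mxE liftK.
have p0 : p ord0 0 = 1 - \sum_j c j by rewrite mxE unlift_none.
exists p; split.
  split.
    by rewrite big_ord_recl p0; under [X in _ + X]eq_bigr do rewrite pl; rewrite subrK.
  rewrite baryE; under eq_bigr do rewrite pl.
  by rewrite -(coord_basis basX (memvf _)) shift_vdiff.
move=> q [q1 Pq].
have ql j : q (lift ord0 j) 0 = c j.
  by rewrite /c Pq baryE vdiff_shift coord_sum_free.
apply/colP => i; case: (unliftP ord0 i) => [j|] ->; first by rewrite pl ql.
rewrite p0 -q1 big_ord_recl; under [X in _ + X - _]eq_bigr do rewrite ql.
by rewrite addrK.
Qed.

End AffineCombinations.

Lemma linfun_linear (R : realType) (V W : vectType R) (f : V -> W) :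
  linear f -> linfun f =1 f.
Proof.
move=> flin x; pose mf := GRing.isLinear.Build R V W *:%R f flin.
by pose F : {linear V -> W} := HB.pack f mf; exact: (lfunE F x).
Qed.

Section AffineMaps.
Variables (R : realType) (V : vectType R) (A : affineType V) (W : vectType R).

Definition is_affine (f : A -> W) : Prop :=
  forall P Q (a b : R), a + b = 1 -> f (acomb P Q b) = a *: f P + b *: f Q.

Definition affine_pred : {pred A -> W} := [pred f | `[< is_affine f >]].

Fact affine_submod_closed : submod_closed affine_pred.
Proof.
split=> [|c f g /asboolP hf /asboolP hg]; apply/asboolP => P Q a b ab.
  have E S : (0 : A -> W) S = 0 by [].
  by rewrite !E !scaler0 addr0.
have E S : (c *: f + g) S = c *: f S + g S by [].
rewrite !E (hf _ _ _ _ ab) (hg _ _ _ _ ab) !scalerDr !scalerA.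
by rewrite [c * a]mulrC [c * b]mulrC addrACA.
Qed.
HB.instance Definition _ :=
  GRing.isSubmodClosed.Build R (A -> W) affine_pred affine_submod_closed.

(* The vector space of affine maps A -> W; Aff(A) is [affmap A R^o]. *)
Record affmap := AffMap {affmap_fun :> A -> W; _ : affmap_fun \in affine_pred}.
HB.instance Definition _ := [isSub for affmap_fun].
HB.instance Definition _ := [Choice of affmap by <:].
HB.instance Definition _ := [SubChoice_isSubLmodule of affmap by <:].

Lemma affmapP (f : affmap) : is_affine f.
Proof. by case: f => f /= /asboolP. Qed.

Lemma affmap_ext (f g : affmap) : (forall P, f P = g P) -> f = g.
Proof. by move=> fg; apply/val_inj/funext. Qed.

Lemma affmapE c (f g : affmap) P : (c *: f + g) P = c *: f P + g P.
Proof. by []. Qed.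

Lemma is_affineP (f : A -> W) P (L : V -> W) : linear L ->
  (forall x, f (shift P x) = f P + L x) -> is_affine f.
Proof.
move=> hL fL Q S a b ab.
rewrite -(shift_vdiff P Q) -(shift_vdiff P S) acomb_shift.
set x := vdiff Q P; set y := vdiff S P; rewrite !fL.
rewrite [x + _]addrC hL -[y - x]addrC -scaleN1r hL scaleN1r.
have -> : a = 1 - b by rewrite -ab addrK.
rewrite [- _ + _]addrC scalerBl scale1r -addrA [- (_ *: _) + _]addrC -scalerBr.
have -> : f P + L y - (f P + L x) = L y - L x.
  by rewrite opprD addrACA subrr add0r.
by rewrite [b *: _ + L x]addrC addrA.
Qed.

Lemma affmap_scale (f : affmap) P b x :
  f (shift P (b *: x)) - f P = b *: (f (shift P x) - f P).
Proof.
rewrite -acomb_shiftr (affmapP f P (shift P x) (subrK b 1)).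
by rewrite scalerBl scale1r scalerBr addrAC [f P - _]addrC addrK addrC.
Qed.

Definition lpart_fun (f : affmap) (x : V) : W :=
  f (shift (origin A) x) - f (origin A).

Fact lpart_linear f : linear (lpart_fun f).
Proof.
rewrite /lpart_fun; set O := origin A => c x y.
have -> : shift O (c *: x + y) =
    acomb (shift O ((2 * c) *: x)) (shift O (2 *: y)) 2^-1.
  rewrite acomb_shift scalerBr !scalerA mulrA mulVf ?pnatr_eq0 // mul1r scale1r.
  by rewrite addrCA -scalerBl; congr (shift _ _); rewrite addrC; congr (_ *: _ + _); field.
have half : 2^-1 + 2^-1 = 1 :> R by field.
rewrite (affmapP f _ _ half).
have E b z : f (shift O (b *: z)) = f O + b *: (f (shift O z) - f O).
  by rewrite -affmap_scale addrC subrK.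
rewrite !E !(scalerDr (2^-1 : R)) addrACA -scalerDl half scale1r.
rewrite addrAC subrr add0r !scalerA mulrA mulVf ?pnatr_eq0 //.
by rewrite mul1r scale1r.
Qed.

(* The linear part of an affine map, independent of the chosen origin (see
   [lpartE]). On Aff(A) = [affmap A R^o], this is the map d to the dual of V. *)
Definition lpart (f : affmap) : 'Hom(V, W) := linfun (lpart_fun f).

Lemma lpartE f P x : lpart f x = f (shift P x) - f P.
Proof.
rewrite (linfun_linear (lpart_linear f)) /lpart_fun -(shift_vdiff (origin A) P) shiftD.
set y := vdiff _ _; have := lpart_linear f 1 y x.
rewrite /lpart_fun !scale1r => h; apply: (addIr (f (shift (origin A) y) - f (origin A))).
by rewrite [RHS]addrA subrK h addrC.
Qed.

Lemma lpart_is_linear : linear lpart.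
Proof.
move=> c f g; apply/lfunP => x; rewrite add_lfunE scale_lfunE.
by rewrite !(lpartE _ (origin A)) !affmapE scalerBr opprD addrACA.
Qed.
End AffineMaps.

Section AffineVect.
Variables (R : realType) (V : vectType R) (A : affineType V) (W : vectType R).

Import VectorInternalTheory.

Fact affmap_vect_iso :
  Vector.axiom (dim (W * 'Hom(V, W))%type) (affmap A W).
Proof.
pose phi (f : affmap A W) : (W * 'Hom(V, W))%type := (f (origin A), lpart f).
have affine_rev (u : W * 'Hom(V, W)) :
    is_affine (fun P : A => u.1 + u.2 (vdiff P (origin A))).
  apply: (@is_affineP _ _ _ _ _ (origin A) u.2) => [|x]; first exact: linearP.
  by rewrite vdiff_shift -[X in vdiff X _](shift0 (origin A)) vdiff_shift
    linear0 addr0.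
pose psi (u : W * 'Hom(V, W)) : affmap A W := AffMap (asboolT (affine_rev u)).
have phiK : cancel phi psi.
  by move=> f; apply: affmap_ext => P; rewrite /= (lpartE _ (origin A))
    shift_vdiff addrC subrK.
have psiK : cancel psi phi.
  case=> w L; rewrite /phi /=; congr (_, _).
    by rewrite -[X in vdiff X _](shift0 (origin A)) vdiff_shift linear0 addr0.
  apply/lfunP => x; rewrite (lpartE _ (origin A)) /= vdiff_shift.
  rewrite -[X in _ - (_ + L (vdiff X _))](shift0 (origin A)) vdiff_shift.
  by rewrite linear0 addr0 addrC addKr.
exists (fun f => v2r (phi f)); last first.
  exists (fun r => psi (r2v r)) => [f|r]; first by rewrite v2rK phiK.
  by rewrite psiK r2vK.
move=> c f g; rewrite -linearP; congr (v2r (_, _)).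
exact: lpart_is_linear.
Qed.
HB.instance Definition _ :=
  Lmodule_hasFinDim.Build R (affmap A W) affmap_vect_iso.

End AffineVect.

Section SymmetricBilinear.
Variables (R : realType) (U : vectType R).

Definition is_symbil (g : U -> U -> R^o) : Prop :=
  @bilinear_for R U U R^o *:%R *:%R g /\ forall x y, g x y = g y x.

Definition symbil_pred : {pred U -> U -> R^o} := [pred g | `[< is_symbil g >]].

Lemma is_symbilP (g : U -> U -> R^o) :
  (forall x y, g x y = g y x) -> (forall x, linear (g x)) -> is_symbil g.
Proof.
move=> gC glin; split=> //; split=> [y c x x'|x]; last exact: glin.
by rewrite !(gC _ y) glin.
Qed.

Fact symbil_submod_closed : submod_closed symbil_pred.
Proof.
split=> [|c f g /asboolP[[_ fl] fC] /asboolP[[_ gl] gC]]; apply/asboolP.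
  apply: is_symbilP => // x c y z.
  have E t : (0 : U -> U -> R^o) x t = 0 by [].
  by rewrite !E scaler0 addr0.
have E x y : (c *: f + g) x y = c *: f x y + g x y by [].
apply: is_symbilP => [x y|x b y z]; first by rewrite !E fC gC.
rewrite !E fl gl !scalerDr !scalerA [c * b]mulrC; exact: addrACA.
Qed.
HB.instance Definition _ :=
  GRing.isSubmodClosed.Build R (U -> U -> R^o) symbil_pred symbil_submod_closed.

(* S^2 of the dual of U: the vector space of symmetric bilinear forms on U. *)
Record symbil :=
  SymBil {symbil_fun :> U -> U -> R^o; _ : symbil_fun \in symbil_pred}.
HB.instance Definition _ := [isSub for symbil_fun].
HB.instance Definition _ := [Choice of symbil by <:].
HB.instance Definition _ := [SubChoice_isSubLmodule of symbil by <:].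

Lemma symbilC (g : symbil) x y : g x y = g y x.
Proof. by case: g => g /= /asboolP[]. Qed.

Lemma symbilPr (g : symbil) x : linear (g x).
Proof. by case: g => g /= /asboolP[[]]. Qed.

Lemma symbilPl (g : symbil) y : linear (g^~ y).
Proof. by case: g => g /= /asboolP[[]]. Qed.

Lemma symbil_ext (g h : symbil) : (forall x y, g x y = h x y) -> g = h.
Proof. by move=> gh; apply/val_inj/funext => x; apply/funext. Qed.

Fact stens_subproof (phi psi : 'Hom(U, R^o)) :
  is_symbil (fun x y => (phi x * psi y + psi x * phi y : R)).
Proof.
apply: is_symbilP => [x y|x c y z].
  by rewrite addrC [psi x * _]mulrC [phi x * _]mulrC.
rewrite (linearP phi) (linearP psi).
have E (a b d e f g : R) : a * (c * d + e) + b * (c * f + g) =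
  c * (a * d + b * f) + (a * e + b * g) by ring.
exact: E.
Qed.

(* phi (x) psi + psi (x) phi *)
Definition stens (phi psi : 'Hom(U, R^o)) : symbil :=
  SymBil (asboolT (stens_subproof phi psi)).

End SymmetricBilinear.

Section LinearHull.
Variables (R : realType) (V : vectType R) (A : affineType V).
Local Notation Aff := (affmap A R^o).
Local Notation hull := 'Hom(Aff, R^o).

Fact cst_affine_subproof (c : R^o) : is_affine (fun _ : A => c).
Proof. by move=> P Q a b ab; rewrite -scalerDl ab scale1r. Qed.

Definition cst_affine (c : R^o) : Aff := AffMap (asboolT (cst_affine_subproof c)).

Definition unit_affine : Aff := cst_affine 1.

(* The point z_P of the linear hull: evaluation of affine functions at P. *)
Definition eval_at (P : A) : hull := linfun (fun f : Aff => f P : R^o).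

Fact eval_at_linear P : linear (fun f : Aff => f P : R^o).
Proof. by []. Qed.

Lemma eval_atE P f : eval_at P f = f P.
Proof. exact: (linfun_linear (@eval_at_linear P)). Qed.

Lemma eval_at_acomb P Q a b : a + b = 1 ->
  eval_at (acomb P Q b) = a *: eval_at P + b *: eval_at Q.
Proof.
move=> ab; apply/lfunP => f; rewrite add_lfunE !scale_lfunE !eval_atE.
exact: affmapP.
Qed.

(* The inclusion of the director space in the linear hull: a vector x is the
   functional f |-> <x, df>. *)
Definition vec_hull (x : V) : hull := linfun (fun f : Aff => lpart f x).

Fact vec_hull_linear x : linear (fun f : Aff => lpart f x).
Proof. by move=> c f g; rewrite lpart_is_linear add_lfunE scale_lfunE. Qed.

Lemma vec_hullE x f : vec_hull x f = lpart f x.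
Proof. exact: (linfun_linear (@vec_hull_linear x)). Qed.

Lemma vec_hull_is_linear : linear vec_hull.
Proof.
move=> c x y; apply/lfunP => f.
by rewrite add_lfunE scale_lfunE !vec_hullE linearP.
Qed.

Lemma vec_hullP (z : hull) :
  z unit_affine = 0 <-> exists x, z = vec_hull x.
Proof.
split=> [z1|[x ->]]; last by rewrite vec_hullE (lpartE _ (origin A)) subrr.
have coordA i : is_affine (fun P : A => coord (vbasis {:V}) i (vdiff P (origin A)) : R^o).
  apply: (@is_affineP _ _ _ R^o _ (origin A) (coord (vbasis {:V}) i)) => [|x].
    exact: linearP.
  by rewrite vdiff_shift vdiffxx linear0 add0r.
pose e i : Aff := AffMap (asboolT (coordA i)).
exists (\sum_(i < \dim {:V}) z (e i) *: (vbasis {:V})`_i); apply/lfunP => f.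
have fE : f = f (origin A) *: unit_affine + \sum_(i < \dim {:V}) lpart f (vbasis {:V})`_i *: e i.
  apply: affmap_ext => P.
  rewrite affmapE -[X in X = _](subrK (f (origin A))) addrC.
  congr (_ + _); first by rewrite /GRing.scale /= mulr1.
  rewrite -{1}(shift_vdiff (origin A) P) -lpartE.
  rewrite {1}(coord_vbasis (memvf (vdiff P (origin A)))) linear_sum.
  rewrite -eval_atE linear_sum; apply: eq_bigr => i _.
  by rewrite !linearZ /= eval_atE /GRing.scale /= mulrC.
rewrite [in LHS]fE linearP /= z1 scaler0 add0r vec_hullE !linear_sum /=.
by apply: eq_bigr => i _; rewrite !linearZ /= /GRing.scale /= mulrC.
Qed.

(* Aff(A) seen as the dual of the linear hull. *)
Definition bidual (f : Aff) : 'Hom(hull, R^o) := linfun (fun z : hull => z f).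

Fact bidual_linear f : linear (fun z : hull => z f).
Proof. by move=> c y z; rewrite add_lfunE scale_lfunE. Qed.

Lemma bidualE f z : bidual f z = z f.
Proof. exact: (linfun_linear (@bidual_linear f)). Qed.

(* The map Id (x) u + u (x) Id from Aff(A) to S^2 Aff(A). *)
Definition tens_unit (f : Aff) : symbil hull :=
  stens (bidual f) (bidual unit_affine).

Fact dd_subproof (g : symbil hull) :
  is_symbil (fun x y => g (vec_hull x) (vec_hull y)).
Proof.
apply: is_symbilP => [x y|x c y z]; first exact: symbilC.
by rewrite vec_hull_is_linear symbilPr.
Qed.

(* The map d (x) d, i.e. the restriction of bilinear forms to the director
   space; see [vec_hullP] and [dd_stens]. *)
Definition dd (g : symbil hull) : symbil V := SymBil (asboolT (dd_subproof g)).

Lemma dd_stens (f h : Aff) :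
  dd (stens (bidual f) (bidual h)) = stens (lpart f) (lpart h).
Proof. by apply: symbil_ext => x y /=; rewrite !bidualE !vec_hullE. Qed.

End LinearHull.

Section Quadratic.
Variables (R : realType) (V : vectType R) (A : affineType V).
Local Notation Aff := (affmap A R^o).
Local Notation hull := 'Hom(Aff, R^o).

Definition is_quadratic (d : A -> R) : Prop :=
  forall P Q (a b : R), a + b = 1 ->
    d (acomb P Q b) = a * (a - b) * d P + b * (b - a) * d Q
                      + 4 * a * b * d (midpoint P Q).

Definition quad_pred : {pred A -> R^o} := [pred d | `[< is_quadratic d >]].

Fact quad_submod_closed : submod_closed quad_pred.
Proof.
split=> [|c f g /asboolP hf /asboolP hg]; apply/asboolP => P Q a b ab.
  have E S : (0 : A -> R^o) S = 0 by [].
  by rewrite !E !mulr0 !addr0.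
have E S : (c *: f + g) S = c * f S + g S by [].
by rewrite !E (hf _ _ _ _ ab) (hg _ _ _ _ ab); ring.
Qed.
HB.instance Definition _ :=
  GRing.isSubmodClosed.Build R (A -> R^o) quad_pred quad_submod_closed.

(* The vector space Quad(A). *)
Record quad := Quad {quad_fun :> A -> R^o; _ : quad_fun \in quad_pred}.
HB.instance Definition _ := [isSub for quad_fun].
HB.instance Definition _ := [Choice of quad by <:].
HB.instance Definition _ := [SubChoice_isSubLmodule of quad by <:].

Lemma quadP (d : quad) : is_quadratic d.
Proof. by case: d => d /= /asboolP. Qed.

Lemma quad_ext (d e : quad) : (forall P, d P = e P) -> d = e.
Proof. by move=> de; apply/val_inj/funext. Qed.

Fact aff_quad_subproof (f : Aff) : is_quadratic f.
Proof.
move=> P Q a b ab; have h : 2^-1 + 2^-1 = 1 :> R by field.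
rewrite (affmapP f P Q ab) (affmapP f P Q h) /GRing.scale /=.
have -> : a = 1 - b by rewrite -ab addrK.
by field.
Qed.

(* The inclusions of Aff(A) and of the constants in Quad(A). *)
Definition aff_quad (f : Aff) : quad := Quad (asboolT (aff_quad_subproof f)).

Fact cst_quad_subproof (c : R^o) : is_quadratic (fun=> c).
Proof.
move=> P Q a b ab; have -> : a = 1 - b by rewrite -ab addrK.
by ring.
Qed.

Definition cst_quad (c : R^o) : quad := Quad (asboolT (cst_quad_subproof c)).

Fact Theta_subproof (g : symbil hull) :
  is_quadratic (fun P => (2^-1 * g (eval_at P) (eval_at P) : R)).
Proof.
have E P Q a b : a + b = 1 -> g (eval_at (acomb P Q b)) (eval_at (acomb P Q b))
    = a ^+ 2 * g (eval_at P) (eval_at P) + b ^+ 2 * g (eval_at Q) (eval_at Q)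
      + 2 * a * b * g (eval_at P) (eval_at Q).
  move=> ab; rewrite (eval_at_acomb P Q ab).
  set x := eval_at P; set y := eval_at Q.
  have lr u : g u (a *: x + b *: y) = a * g u x + b * g u y.
    have h := symbilPr g u b y 0; have h0 := symbilPr g u 1 0 0.
    rewrite symbilPr; congr (_ + _).
    move: h h0; rewrite scale1r !addr0 => -> h0.
    have -> : g u 0 = 0.
      by apply: (addrI (g u 0)); rewrite addr0 {3}h0 scale1r.
    by rewrite addr0.
  rewrite lr !(symbilC g (_ + _)) !lr (symbilC g y x).
  by ring.
move=> P Q a b ab; have h : 2^-1 + 2^-1 = 1 :> R by field.
rewrite (E _ _ _ _ ab) (E _ _ _ _ h).
have -> : a = 1 - b by rewrite -ab addrK.
by field.
Qed.

Definition Theta (g : symbil hull) : quad := Quad (asboolT (Theta_subproof g)).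

(* The restriction of a quadratic function to a plane, in coordinates, has no
   monomial of degree more than 2. *)
Lemma quad_grid (F : R -> R -> R) :
  (forall p q s t, F (p + 2 * s) (q + 2 * t) =
     3 * F (p + s) (q + t) - 3 * F p q + F (p - s) (q - t)) ->
  F 1 1 - F (-1) (-1) = F 1 0 - F (-1) 0 + (F 0 1 - F 0 (-1)) /\
  F 1 1 - F (-1) 1 - (F 1 0 - F (-1) 0) =
    2^-1 * (F 1 1 - F (-1) 1 - F 1 (-1) + F (-1) (-1)).
Proof.
move=> H.
have E p q s t a b c d e g : a = p + 2 * s -> b = q + 2 * t -> c = p + s ->
    d = q + t -> e = p - s -> g = q - t ->
    F a b = 3 * F c d - 3 * F p q + F e g.
  by move=> -> -> -> -> -> ->.
have r1 j : F 2 j = 3 * F 1 j - 3 * F 0 j + F (-1) j.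
  by apply: (E _ _ 1 0); lra.
have r2 j : F (-2) j = 3 * F (-1) j - 3 * F 0 j + F 1 j.
  by apply: (E _ _ (-1) 0); lra.
have c1 i : F i 2 = 3 * F i 1 - 3 * F i 0 + F i (-1).
  by apply: (E _ _ 0 1); lra.
have c2 i : F i (-2) = 3 * F i (-1) - 3 * F i 0 + F i 1.
  by apply: (E _ _ 0 (-1)); lra.
have d1 : F 2 2 = 3 * F 1 1 - 3 * F 0 0 + F (-1) (-1).
  by apply: (E _ _ 1 1); lra.
have d2 : F (-2) (-2) = 3 * F (-1) (-1) - 3 * F 0 0 + F 1 1.
  by apply: (E _ _ (-1) (-1)); lra.
have d3 : F 2 (-2) = 3 * F 1 (-1) - 3 * F 0 0 + F (-1) 1.
  by apply: (E _ _ 1 (-1)); lra.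
have d4 : F (-2) 2 = 3 * F (-1) 1 - 3 * F 0 0 + F 1 (-1).
  by apply: (E _ _ (-1) 1); lra.
move: d1 d2 d3 d4; rewrite !r1 !r2 !c1 !c2 => d1 d2 d3 d4.
by split; lra.
Qed.

Lemma quad_plane (d : quad) P x y :
  let F (s t : R) : R := d (shift P (s *: x + t *: y)) in
  F 1 1 - F (-1) (-1) = F 1 0 - F (-1) 0 + (F 0 1 - F 0 (-1)) /\
  F 1 1 - F (-1) 1 - (F 1 0 - F (-1) 0) =
    2^-1 * (F 1 1 - F (-1) 1 - F 1 (-1) + F (-1) (-1)).
Proof.
move=> F; apply: quad_grid => p q s t; rewrite /F.
pose v := s *: x + t *: y; pose w := p *: x + q *: y.
have Ew k : shift P ((p + k * s) *: x + (q + k * t) *: y) = shift P (w + k *: v).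
  by rewrite !scalerDl -!scalerA addrACA -scalerDr.
have E1 := Ew 1; have E2 := Ew 2; have E3 := Ew (-1).
rewrite !mul1r scale1r in E1; rewrite !mulN1r scaleN1r in E3.
rewrite E1 E2 E3.
have h : (- 2^-1) + (3 / 2) = 1 :> R by field.
have := quadP d (shift P (w - v)) (shift P (w + v)) h.
rewrite /midpoint !acomb_shift.
have -> : w + v - (w - v) = v + v by rewrite opprB addrC addrA subrK.
have -> : (3 / 2 : R) *: (v + v) = 3 *: v.
  by rewrite -mulr2n -scaler_nat scalerA; congr (_ *: _); field.
have -> : (2^-1 : R) *: (v + v) = v.
  by rewrite -mulr2n -scaler_nat scalerA mulVf ?pnatr_eq0// scale1r.
have -> : w - v + 3 *: v = w + 2 *: v.
  rewrite -addrA; congr (_ + _); rewrite -scaleN1r -scalerDl.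
  by congr (_ *: _); ring.
rewrite subrK => ->.
by field.
Qed.

(* delta^h_P, where [acomb P Q (-1)] is 2 P - Q *)
Definition hpart (d : quad) (P Q : A) : R^o :=
  2^-1 * (d Q + d (acomb P Q (- 1))) - d P.

Definition odd_part (d : quad) (P : A) (x : V) : R^o :=
  2^-1 * (d (shift P x) - d (shift P (- x))).

Lemma odd_part_linear d P : linear (odd_part d P).
Proof.
have hZ c x : odd_part d P (c *: x) = c * odd_part d P x.
  have h : (1 - c) + c = 1 by rewrite subrK.
  have E z : d (shift P (c *: z)) = (1 - c) * (1 - c - c) * d P +
      c * (c - (1 - c)) * d (shift P z) +
      4 * (1 - c) * c * d (shift P (2^-1 *: z)).
    have := quadP d P (shift P z) h.
    by rewrite /midpoint !acomb_shiftr.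
  have E' z : d (shift P (2^-1 *: z)) = - 8^-1 * d (shift P (- z)) +
      3 / 8 * d (shift P z) + 3 / 4 * d P.
    have h' : 4^-1 + 3 / 4 = 1 :> R by field.
    have := quadP d (shift P (- z)) (shift P z) h'.
    rewrite /midpoint !acomb_shift opprK.
    have -> : (2^-1 : R) *: (z + z) = z.
      by rewrite -mulr2n -scaler_nat scalerA mulVf ?pnatr_eq0// scale1r.
    rewrite addNr shift0.
    have -> : - z + (3 / 4 : R) *: (z + z) = 2^-1 *: z.
      rewrite -mulr2n -scaler_nat scalerA -scaleN1r -scalerDl.
      by congr (_ *: _); field.
    by move=> ->; field.
  by rewrite /odd_part -scalerN !E !E' opprK; field.
move=> c x y; have -> : c *: odd_part d P x = odd_part d P (c *: x) by rewrite hZ.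
move: (c *: x) => {}x.
have /= [h _] := quad_plane d P x y.
rewrite !scale1r !scale0r !scaleN1r !addr0 !add0r -opprD in h.
by rewrite /odd_part h; field.
Qed.

Fact affine_part_affine (d : quad) P :
  is_affine (fun Q => d Q - hpart d P Q : R^o).
Proof.
apply: (@is_affineP _ _ _ _ _ P (odd_part d P)) => [|x].
  exact: odd_part_linear.
have E0 : acomb P P (-1) = P.
  by rewrite -{2}(shift0 P) acomb_shiftr scaler0 shift0.
by rewrite /hpart /odd_part acomb_shiftr scaleN1r E0; field.
Qed.

Definition affine_part (d : quad) (P : A) : Aff :=
  AffMap (asboolT (affine_part_affine d P)).

Definition grad_at (d : quad) (P : A) : 'Hom(V, R^o) := lpart (affine_part d P).

Lemma grad_atE d P x : grad_at d P x = odd_part d P x.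
Proof.
rewrite /grad_at (lpartE _ P) /=.
have E0 : acomb P P (-1) = P.
  by rewrite -{2}(shift0 P) acomb_shiftr scaler0 shift0.
by rewrite /hpart /odd_part acomb_shiftr scaleN1r E0; field.
Qed.

Lemma grad_at_sym d P x y : grad_at d (shift P y) x - grad_at d P x =
  grad_at d (shift P x) y - grad_at d P y.
Proof.
rewrite !grad_atE /odd_part !shiftD.
have /= [_ h] := quad_plane d P x y; have /= [_ k] := quad_plane d P y x.
rewrite !scale1r !scale0r !scaleN1r !addr0 in h k.
rewrite (addrC y x) (addrC (- y) x) (addrC y (- x)) (addrC (- y) (- x)) in k.
rewrite (addrC y x) (addrC y (- x)) -!mulrBr h k.
by field.
Qed.

Fact grad_affine d : is_affine (grad_at d).
Proof.
apply: (@is_affineP _ _ _ _ _ (origin A)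
  (fun x => grad_at d (shift (origin A) x) - grad_at d (origin A))) => [c x y|x].
  apply/lfunP => z; rewrite !(add_lfunE, scale_lfunE, opp_lfunE).
  rewrite !(grad_at_sym d (origin A) z).
  rewrite (linearP (grad_at d (shift (origin A) z))).
  rewrite (linearP (grad_at d (origin A))) opprD addrACA.
  by rewrite -scalerBr.
by rewrite addrC subrK.
Qed.

End Quadratic.

Section Gradient.
Variables (R : realType) (V : vectType R) (A : affineType V).
Local Notation dirdual := 'Hom(V, R^o).

Definition affS_pred : {pred affmap A dirdual} :=
  [pred w : affmap A dirdual | `[< forall x y, lpart w y x = lpart w x y >]].

Fact affS_submod_closed : submod_closed affS_pred.
Proof.
split=> [|c f g /asboolP hf /asboolP hg]; apply/asboolP => x y.
  have E z : lpart (0 : affmap A dirdual) z = 0.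
    by rewrite (lpartE _ (origin A)); exact: subrr.
  by rewrite !E !zero_lfunE.
by rewrite lpart_is_linear !(add_lfunE, scale_lfunE) hf hg.
Qed.
HB.instance Definition _ :=
  GRing.isSubmodClosed.Build R (affmap A dirdual) affS_pred affS_submod_closed.

(* Aff^S(A, dual of V): affine maps with symmetric principal component. *)
Record affS :=
  AffS {affS_map :> affmap A dirdual; _ : affS_map \in affS_pred}.
HB.instance Definition _ := [isSub for affS_map].
HB.instance Definition _ := [Choice of affS by <:].
HB.instance Definition _ := [SubChoice_isSubLmodule of affS by <:].

Fact principal_subproof (w : affS) : is_symbil (fun x y => lpart w y x : R^o).
Proof.
case: w => w /= /asboolP hw; apply: is_symbilP => [x y|x c y z].
  exact: hw.
by rewrite linearP add_lfunE scale_lfunE.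
Qed.

(* The principal component (x, y) |-> <x, w(P + y) - w(P)>. *)
Definition principal (w : affS) : symbil V := SymBil (asboolT (principal_subproof w)).

Fact grad_subproof (d : quad A) :
  AffMap (asboolT (grad_affine d)) \in affS_pred.
Proof.
apply/asboolP => x y; rewrite !(lpartE _ (origin A)) /=.
by rewrite !add_lfunE !opp_lfunE grad_at_sym.
Qed.

Definition grad (d : quad A) : affS := AffS (grad_subproof d).

Definition Hess (d : quad A) : symbil V := principal (grad d).

End Gradient.

(* The row 0 -> E -> F -> G -> 0 is an exact sequence of linear maps. *)
Definition short_exact (R : realType) (E F G : lmodType R)
    (f : E -> F) (g : F -> G) : Prop :=
  [/\ linear f, linear g, injective f,
      (forall y, g y = 0 <-> exists x, f x = y) &
      (forall z, exists y, g y = z)].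

Definition gram (R : realType) (V : vectType R) (A : affineType V) n
    (Rp : 'I_n.+1 -> A) (g : symbil 'Hom(affmap A R^o, R^o)) : 'M[R]_n.+1 :=
  \matrix_(i, j) g (eval_at (Rp i)) (eval_at (Rp j)).

(* Main.v *)
From HB Require Import structures.
Require Import Defs.
From mathcomp Require Import all_boot all_order all_algebra.
From mathcomp Require Import ring.
From mathcomp Require Import boolp classical_sets functions reals.
Set Implicit Arguments.
Unset Strict Implicit.

Import GRing.Theory Num.Theory.
Local Open Scope ring_scope.

(** The points z_P span the linear hull and the identity

      g(z_P, z_Q) = 4 delta((P + Q)/2) - delta(P) - delta(Q)

    recovers g = Theta^-1(delta) on them ([polarization]), which gives the
    injectivity of Theta.  Surjectivity is the second-order Taylor formula
    ([quad_taylor])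

      delta(Q) = (delta - delta^h_P)(Q) + 1/2 Hess delta (Q - P, Q - P),

    itself an instance on the line PQ of the defining identity of quadratic
    functions.  Its affine part f is Theta(f (x) u + u (x) f), and its second
    part is Theta of the Hessian pulled back along the projection of the linear
    hull onto its director space given by a chosen point ([pull_form]).

    The same decomposition gives both exact rows.  From
    grad_P(Theta g) = g(z_P, .) one gets Hess o Theta = d (x) d; hence a form g
    killed by d (x) d has a quadratic function equal to its affine part, and g
    comes from Aff(A).  A quadratic function with zero gradient is constant by
    Taylor.  Preimages are explicit: a pulled back form for d (x) d, and for an
    affine field w the function
    <w_O, P - O> + 1/2 <P - O, vec w (P - O)> for the gradient.

    In a referential, z_P = sum_i p_i z_{R_i} turns g into the matrix product
    p^t G q, so the Gram matrix determines g; conversely the affine functions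
    dual to the R_i (the barycentric coordinates) build a form with any given
    symmetric Gram matrix. *)

(** * Symmetric bilinear forms *)

HB.instance Definition _ (R : realType) (U : vectType R) (g : symbil U) x :=
  GRing.isLinear.Build R U R^o *:%R (g x) (symbilPr g x).

Lemma symbilDl (R : realType) (U : vectType R) (g : symbil U) x y z :
  g (x + y) z = g x z + g y z.
Proof. by rewrite !(symbilC g _ z) linearD. Qed.

Lemma symbilZl (R : realType) (U : vectType R) (g : symbil U) c x z :
  g (c *: x) z = c * g x z.
Proof. by rewrite !(symbilC g _ z) linearZ. Qed.

Lemma symbilDr (R : realType) (U : vectType R) (g : symbil U) x y z :
  g z (x + y) = g z x + g z y.
Proof. by rewrite linearD. Qed.

Lemma symbilZr (R : realType) (U : vectType R) (g : symbil U) c x z :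
  g z (c *: x) = c * g z x.
Proof. by rewrite linearZ. Qed.

Lemma symbilE (R : realType) (U : vectType R) (c : R) (g h : symbil U) x y :
  (c *: g + h) x y = c * g x y + h x y.
Proof. by []. Qed.

(** * The linear hull of an affine space *)

Section Hull.
Variables (R : realType) (V : vectType R) (A : affineType V).
Local Notation Aff := (affmap A R^o).
Local Notation hull := 'Hom(Aff, R^o).

Lemma eval_at_shift (P : A) (x : V) :
  eval_at (shift P x) = eval_at P + vec_hull A x.
Proof.
apply/lfunP => f; rewrite add_lfunE !eval_atE vec_hullE (lpartE f P).
by rewrite addrC subrK.
Qed.

Lemma vec_hullN x : vec_hull A (- x) = - vec_hull A x.
Proof. by apply/lfunP => f; rewrite opp_lfunE !vec_hullE linearN. Qed.

Lemma vec_hull_sum n (c : 'I_n -> R) (x : 'I_n -> V) :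
  vec_hull A (\sum_i c i *: x i) = \sum_i c i *: vec_hull A (x i).
Proof.
apply/lfunP => f; rewrite vec_hullE linear_sum sum_lfunE.
by apply: eq_bigr => i _; rewrite linearZ scale_lfunE vec_hullE.
Qed.

Lemma vec_hull_vdiff (P Q : A) : vec_hull A (vdiff Q P) = eval_at Q - eval_at P.
Proof.
by rewrite -{2}(shift_vdiff P Q) eval_at_shift [eval_at P + _]addrC addrK.
Qed.

Lemma eval_at_unit (P : A) : eval_at P (unit_affine A) = 1.
Proof. by rewrite eval_atE. Qed.

Lemma vec_hull_unit (x : V) : vec_hull A x (unit_affine A) = 0.
Proof. by apply/vec_hullP; exists x. Qed.

Lemma hull_decomp (P : A) (z : hull) :
  exists x, z = z (unit_affine A) *: eval_at P + vec_hull A x.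
Proof.
have /vec_hullP[x hx] :
    (z - z (unit_affine A) *: eval_at P) (unit_affine A) = 0.
  rewrite add_lfunE opp_lfunE scale_lfunE eval_at_unit.
  by rewrite /GRing.scale /= mulr1 subrr.
by exists x; rewrite -hx addrC subrK.
Qed.

(** Forms on the linear hull are tested on points: every z equals
    a z_O + z_P for a suitable scalar a and point P. *)
Lemma symbil_hull_ext (g h : symbil hull) :
  (forall P Q : A, g (eval_at P) (eval_at Q) = h (eval_at P) (eval_at Q)) ->
  g = h.
Proof.
move=> gh; pose O := origin A.
have pt (z : hull) : exists c P, z = c *: eval_at O + eval_at P.
  have [x ->] := hull_decomp O z.
  exists (z (unit_affine A) - 1), (shift O x).
  by rewrite eval_at_shift addrA scalerBl scale1r subrK.
apply: symbil_ext => z w; have [a [P ->]] := pt z; have [b [Q ->]] := pt w.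
by rewrite !(symbilDl, symbilZl, symbilDr, symbilZr) !gh.
Qed.

Fact affine_of_linear_subproof (P : A) (phi : 'Hom(V, R^o)) :
  is_affine (fun Q => phi (vdiff Q P)).
Proof.
apply: (@is_affineP _ _ _ R^o _ P phi) => [|x]; first exact: linearP.
by rewrite vdiff_shift vdiffxx linear0 add0r.
Qed.

Definition affine_of_linear (P : A) (phi : 'Hom(V, R^o)) : Aff :=
  AffMap (asboolT (affine_of_linear_subproof P phi)).

Lemma lpart_affine_of_linear P phi : lpart (affine_of_linear P phi) = phi.
Proof.
by apply/lfunP => x; rewrite (lpartE _ P) /= vdiff_shift vdiffxx linear0 subr0.
Qed.

(** Each coordinate on the director space extends to an affine function, so
    that affine functions separate vectors. *)
Lemma vec_hull_inj : injective (@vec_hull R V A).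
Proof.
move=> x y /lfunP xy; rewrite (coord_vbasis (memvf x)) (coord_vbasis (memvf y)).
apply: eq_bigr => i _; congr (_ *: _).
pose phi := linfun (coord (vbasis {:V}) i : V -> R^o).
have E z : vec_hull A z (affine_of_linear (origin A) phi) =
    coord (vbasis {:V}) i z.
  by rewrite vec_hullE lpart_affine_of_linear lfunE.
by rewrite -!E xy.
Qed.

(** A left inverse of the inclusion of the director space; its values on other
    elements of the linear hull depend on an arbitrary complement, which the
    projection [hull_proj] below corrects by removing the component along z_P. *)
Definition vec_of_hull : 'Hom(hull, V) := (linfun (@vec_hull R V A))^-1%VF.

Lemma vec_hullK : cancel (@vec_hull R V A) vec_of_hull.
Proof.
move=> x; have ker0 : lker (linfun (@vec_hull R V A)) == 0%VS.
  apply/lker0P => y z; rewrite !(linfun_linear (@vec_hull_is_linear R V A)).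
  exact: vec_hull_inj.
have := lker0_lfunK ker0 x.
by rewrite (linfun_linear (@vec_hull_is_linear R V A)).
Qed.

(** The projection onto the director space along the line spanned by z_P. *)
Definition hull_proj (P : A) (z : hull) : V :=
  vec_of_hull (z - z (unit_affine A) *: eval_at P).

Lemma hull_proj_linear P : linear (hull_proj P).
Proof.
move=> c y z; rewrite /hull_proj -linearP; congr (vec_of_hull _).
rewrite add_lfunE scale_lfunE scalerDl scalerBr opprD addrACA.
by rewrite scalerA.
Qed.

Lemma hull_proj_vec P x : hull_proj P (vec_hull A x) = x.
Proof. by rewrite /hull_proj vec_hull_unit scale0r subr0 vec_hullK. Qed.

Lemma hull_proj_eval P Q : hull_proj P (eval_at Q) = vdiff Q P.
Proof.
by rewrite /hull_proj eval_at_unit scale1r -vec_hull_vdiff vec_hullK.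
Qed.

Fact pull_form_subproof P (h : symbil V) :
  is_symbil (fun z w => h (hull_proj P z) (hull_proj P w)).
Proof.
apply: is_symbilP => [z w|z c w t]; first exact: symbilC.
by rewrite hull_proj_linear linearP.
Qed.

(** The extension of a form on the director space by z_P in its radical: it is
    a section of d (x) d, and Theta maps it to the quadratic function centred
    at P with the given Hessian and value 0 at P. *)
Definition pull_form P (h : symbil V) : symbil hull :=
  SymBil (asboolT (pull_form_subproof P h)).

Lemma dd_pull_form P h : dd (pull_form P h) = h.
Proof. by apply: symbil_ext => x y /=; rewrite !hull_proj_vec. Qed.

Lemma tens_unitE (f : Aff) z w :
  tens_unit f z w = z f * w (unit_affine A) + z (unit_affine A) * w f.
Proof. by rewrite /= !bidualE. Qed.

Lemma dd_tens_unit (f : Aff) : dd (tens_unit f) = 0 :> symbil V.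
Proof.
apply: symbil_ext => x y.
transitivity (tens_unit f (vec_hull A x) (vec_hull A y)); first by [].
by rewrite tens_unitE !vec_hull_unit mulr0 mul0r addr0.
Qed.

Lemma dd_linear : linear (@dd R V A).
Proof. by move=> c g h; apply: symbil_ext. Qed.

Lemma tens_unit_linear : linear (@tens_unit R V A).
Proof.
move=> c f h; apply: symbil_hull_ext => P Q.
rewrite symbilE !tens_unitE !eval_at_unit !eval_atE !mul1r !mulr1.
by rewrite !affmapE /GRing.scale /=; ring.
Qed.

End Hull.

(** * Quadratic functions and their gradients *)

Section Quad.
Variables (R : realType) (V : vectType R) (A : affineType V).
Local Notation Aff := (affmap A R^o).
Local Notation hull := 'Hom(Aff, R^o).

Lemma ThetaE (g : symbil hull) P :
  Theta g P = 2^-1 * g (eval_at P) (eval_at P).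
Proof. by []. Qed.

(** The midpoint has z = (z_P + z_Q)/2, so this is the usual polarization of
    the quadratic form z |-> g(z, z). *)
Lemma polarization (g : symbil hull) P Q :
  g (eval_at P) (eval_at Q) =
    4 * Theta g (midpoint P Q) - Theta g P - Theta g Q.
Proof.
have h : 2^-1 + 2^-1 = 1 :> R by field.
rewrite !ThetaE /midpoint (eval_at_acomb P Q h).
rewrite !(symbilDl, symbilZl, symbilDr, symbilZr).
by rewrite (symbilC g (eval_at Q) (eval_at P)); field.
Qed.

Lemma Theta_inj : injective (@Theta R V A).
Proof.
by move=> g h gh; apply: symbil_hull_ext => P Q; rewrite !polarization gh.
Qed.

Lemma Theta_linear : linear (@Theta R V A).
Proof.
move=> c g h; apply: quad_ext => P.
have -> : (c *: Theta g + Theta h) P = c * Theta g P + Theta h P by [].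
by rewrite !ThetaE symbilE; ring.
Qed.

Lemma Theta_tens_unit (f : Aff) : Theta (tens_unit f) = aff_quad f.
Proof.
apply: quad_ext => P; rewrite ThetaE tens_unitE eval_at_unit eval_atE /=.
by field.
Qed.

(** The gradient of Theta g at P is the odd part of x |-> 1/2 g(z_P + x, z_P + x),
    i.e. its cross term. *)
Lemma grad_Theta (g : symbil hull) P x :
  grad_at (Theta g) P x = g (eval_at P) (vec_hull A x).
Proof.
rewrite grad_atE /odd_part !ThetaE !eval_at_shift vec_hullN.
rewrite -[- vec_hull A x]scaleN1r.
rewrite !(symbilDl, symbilZl, symbilDr, symbilZr).
by rewrite (symbilC g (vec_hull A x) (eval_at P)); field.
Qed.

Lemma HessE (d : quad A) P x y :
  Hess d x y = grad_at d (shift P y) x - grad_at d P x.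
Proof.
rewrite /Hess /= (lpartE _ P) /=.
by rewrite add_lfunE opp_lfunE.
Qed.

Lemma Hess_Theta (g : symbil hull) : Hess (Theta g) = dd g.
Proof.
apply: symbil_ext => x y; rewrite (HessE _ (origin A)) !grad_Theta.
by rewrite eval_at_shift symbilDl addrAC subrr add0r symbilC.
Qed.

(** The point P + 2x lies on the line through P - x and P + x, whose midpoint
    is P. *)
Lemma quad_double (d : quad A) P x :
  d (shift P (x + x)) = 3 * d (shift P x) - 3 * d P + d (shift P (- x)).
Proof.
(* P + 2x = - 1/2 (P - x) + 3/2 (P + x) *)
have h : - 2^-1 + 3 / 2 = 1 :> R by field.
have := quadP d (shift P (- x)) (shift P x) h.
rewrite /midpoint !acomb_shift opprK -mulr2n -scaler_nat !scalerA.
rewrite mulVf ?pnatr_eq0// divfK ?pnatr_eq0// scale1r addNr shift0.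
have -> : - x + 3 *: x = 2 *: x.
  by rewrite -scaleN1r -scalerDl; congr (_ *: _); ring.
by move=> ->; field.
Qed.

Lemma affine_partE (d : quad A) P x :
  affine_part d P (shift P x) = d P + odd_part d P x.
Proof.
by rewrite /= /hpart /odd_part acomb_shiftr scaleN1r; field.
Qed.

(** The remainder delta^h_P(P + x) = (delta(P + x) + delta(P - x))/2 - delta(P)
    is half the Hessian: Hess delta (x, x) is the difference of the gradients at
    P + x and P in the direction x, hence only involves delta at P + 2x, P + x,
    P, P - x, and [quad_double] eliminates P + 2x. *)
Lemma quad_taylor (d : quad A) P Q :
  d Q = affine_part d P Q + 2^-1 * Hess d (vdiff Q P) (vdiff Q P).
Proof.
rewrite -{1 2}(shift_vdiff P Q) affine_partE; set x := vdiff Q P.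
rewrite (HessE _ P) !grad_atE /odd_part !shiftD subrr shift0 quad_double.
by field.
Qed.

(** The two terms of the Taylor formula at the origin, lifted to the linear
    hull. *)
Definition Theta_inv (d : quad A) : symbil hull :=
  tens_unit (affine_part d (origin A)) + pull_form (origin A) (Hess d).

Lemma Theta_pull_form (P : A) (h : symbil V) Q :
  Theta (pull_form P h) Q = 2^-1 * h (vdiff Q P) (vdiff Q P).
Proof. by rewrite ThetaE /= !hull_proj_eval. Qed.

Lemma Theta_invK : cancel Theta_inv (@Theta R V A).
Proof.
move=> d; apply: quad_ext => P; rewrite (quad_taylor d (origin A) P).
rewrite /Theta_inv -[tens_unit _]scale1r Theta_linear scale1r.
by rewrite Theta_tens_unit -Theta_pull_form.
Qed.

Lemma ThetaK : cancel (@Theta R V A) Theta_inv.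
Proof. by move=> g; apply: Theta_inj; rewrite Theta_invK. Qed.

Lemma grad_at_linear P : linear (fun d : quad A => grad_at d P).
Proof.
move=> c d e; apply/lfunP => x.
rewrite add_lfunE scale_lfunE !grad_atE /odd_part.
have E Q : (c *: d + e) Q = c * d Q + e Q by [].
by rewrite !E /GRing.scale /=; ring.
Qed.

Lemma affS_ext (w w' : affS A) : (forall P, w P = w' P) -> w = w'.
Proof. by move=> ww; apply/val_inj/affmap_ext. Qed.

(** An affine field is its value at a point plus its principal component; this
    reduces the surjectivity of the gradient to these two data. *)
Lemma affS_taylor (w : affS A) P Q x :
  w Q x = w P x + principal w x (vdiff Q P).
Proof.
rewrite /= (lpartE _ P) shift_vdiff add_lfunE opp_lfunE.
by rewrite addrC subrK.
Qed.

Lemma grad_linear : linear (@grad R V A).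
Proof.
by move=> c d e; apply: affS_ext => P; exact: (grad_at_linear P c d e).
Qed.

Lemma principal_linear : linear (@principal R V A).
Proof.
move=> c v w; apply: symbil_ext => x y.
rewrite symbilE.
transitivity (lpart (c *: affS_map v + affS_map w) y x); first by [].
by rewrite lpart_is_linear !(add_lfunE, scale_lfunE).
Qed.

Lemma grad_eq0 (d : quad A) : grad d = 0 <-> exists c, cst_quad A c = d.
Proof.
split=> [d0|[c <-]].
  have g0 P : grad_at d P = 0.
    by transitivity (affmap_fun (affS_map (grad d)) P); last by rewrite d0.
  exists (d (origin A)); apply: quad_ext => P /=.
  rewrite [RHS](quad_taylor d (origin A)) (HessE _ (origin A)) !g0 subrr mulr0.
  rewrite addr0 -(shift_vdiff (origin A) P) affine_partE -grad_atE g0.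
  by rewrite zero_lfunE addr0.
apply: affS_ext => P; apply/lfunP => x.
transitivity (grad_at (cst_quad A c) P x); first by [].
by rewrite grad_atE /odd_part /= subrr mulr0 zero_lfunE.
Qed.

(** The quadratic function is taken to vanish at the origin O, with gradient
    w_O there and with the principal component of w as Hessian. *)
Lemma grad_surj (w : affS A) : exists d, grad d = w.
Proof.
pose O := origin A.
pose g := tens_unit (affine_of_linear O (w O)) + pull_form O (principal w).
exists (Theta g); apply: affS_ext => P; apply/lfunP => x.
rewrite (affS_taylor w O).
transitivity (grad_at (Theta g) P x); first by [].
rewrite grad_Theta /g -[tens_unit _]scale1r symbilE mul1r tens_unitE.
rewrite eval_at_unit vec_hull_unit mulr0 add0r mul1r vec_hullE lpart_affine_of_linear.
rewrite [X in _ + X]/=.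
(* the two arguments of vec w come in the opposite order *)
by rewrite hull_proj_eval hull_proj_vec symbilC.
Qed.

(** If d (x) d kills g then the Hessian of Theta g vanishes, so that Theta g is
    its own affine part f, and Theta(f (x) u + u (x) f) = f. *)
Lemma dd_eq0 (g : symbil hull) : dd g = 0 <-> exists f, tens_unit f = g.
Proof.
split=> [g0|[f <-]]; last exact: dd_tens_unit.
exists (affine_part (Theta g) (origin A)); apply: Theta_inj.
rewrite Theta_tens_unit; apply: quad_ext => P.
rewrite [RHS](quad_taylor _ (origin A)) Hess_Theta g0.
by rewrite [X in _ + _ * X](_ : _ = 0) // mulr0 addr0.
Qed.

Lemma aff_quad_inj : injective (@aff_quad R V A).
Proof.
by move=> f h fh; apply: affmap_ext => P; have := congr1 (fun d : quad A => d P) fh.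
Qed.

Lemma tens_unit_inj : injective (@tens_unit R V A).
Proof.
by move=> f h fh; apply: aff_quad_inj; rewrite -!Theta_tens_unit fh.
Qed.

End Quad.

(** * Coordinates in an affine referential *)

Section Frame.
Variables (R : realType) (V : vectType R) (A : affineType V) (n : nat).
Hypothesis dimV : \dim {:V} = n.
Variable Rp : 'I_n.+1 -> A.
Hypothesis indRp : affinely_independent Rp.
Local Notation Aff := (affmap A R^o).
Local Notation hull := 'Hom(Aff, R^o).

Lemma eval_at_bary P p : bary_coords Rp P p ->
  eval_at P = \sum_i p i 0 *: eval_at (Rp i).
Proof.
move=> [p1 ->]; rewrite /bary eval_at_shift vec_hull_sum.
under eq_bigr do rewrite vec_hull_vdiff scalerBr.
by rewrite sumrB -scaler_suml p1 scale1r addrC subrK.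
Qed.

Lemma gram_bary (g : symbil hull) P Q p q :
  bary_coords Rp P p -> bary_coords Rp Q q ->
  g (eval_at P) (eval_at Q) = (p^T *m gram Rp g *m q) 0 0.
Proof.
move=> hP hQ; rewrite [X in g _ X](eval_at_bary hQ) linear_sum mxE.
apply: eq_bigr => j _; rewrite /= symbilZr symbilC (eval_at_bary hP) linear_sum.
rewrite [RHS]mulrC; congr (_ * _); rewrite mxE; apply: eq_bigr => i _.
by rewrite /= symbilZr !mxE symbilC.
Qed.

Lemma gram_sym (g : symbil hull) : (gram Rp g)^T = gram Rp g.
Proof. by apply/matrixP => i j; rewrite !mxE symbilC. Qed.

(** Forms are tested on points, and the Gram matrix gives their values there by
    [gram_bary], since every point has barycentric coordinates. *)
Lemma gram_inj : injective (@gram R V A n Rp).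
Proof.
move=> g h gh; apply: symbil_hull_ext => P Q.
have [p [hp _]] := bary_coords_exists P dimV indRp.
have [q [hq _]] := bary_coords_exists Q dimV indRp.
by rewrite !(gram_bary _ hp hq) gh.
Qed.

Definition edges := [tuple vdiff (Rp (lift ord0 i)) (Rp ord0) | i < n].

Definition edge_fun (i : 'I_n) : Aff :=
  affine_of_linear (Rp ord0) (linfun (coord edges i : V -> R^o)).

(** The barycentric coordinate functions; through [bidual] they form the basis
    dual to the z_{R_i}. *)
Definition bary_fun (j : 'I_n.+1) : Aff :=
  if unlift ord0 j is Some i then edge_fun i
  else unit_affine A - \sum_i edge_fun i.

Lemma edge_fun0 i : edge_fun i (Rp ord0) = 0.
Proof. by rewrite /edge_fun /= vdiffxx linear0. Qed.

Lemma edge_fun_lift i k : edge_fun i (Rp (lift ord0 k)) = (k == i)%:R.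
Proof.
rewrite /= lfunE /=.
have -> : vdiff (Rp (lift ord0 k)) (Rp ord0) = edges`_k.
  by rewrite -tnth_nth tnth_mktuple.
by rewrite coord_free // eq_sym.
Qed.

Lemma bary_fun_vertex i j : bary_fun j (Rp i) = (i == j)%:R.
Proof.
rewrite /bary_fun; case: unliftP => [l|] ->.
  by case: (unliftP ord0 i) => [k|] ->; rewrite ?edge_fun_lift ?edge_fun0 //
    (inj_eq (@lift_inj _ ord0)).
rewrite -eval_atE linearB linear_sum /= eval_at_unit.
under eq_bigr do rewrite eval_atE.
case: (unliftP ord0 i) => [k|] ->.
  under eq_bigr do rewrite edge_fun_lift.
  rewrite (bigD1 k) //= eqxx big1 ?addr0 ?subrr // => l lk.
  by rewrite eq_sym (negbTE lk).
by under eq_bigr do rewrite edge_fun0; rewrite big1 ?subr0 ?eqxx.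
Qed.

Fact form_of_subproof (G : 'M[R]_n.+1) : G^T = G ->
  is_symbil (fun z w : hull =>
    \sum_i \sum_j G i j * (z (bary_fun i) * w (bary_fun j)) : R).
Proof.
move=> GT; apply: is_symbilP => [z w|z c w t].
  rewrite exchange_big; apply: eq_bigr => i _; apply: eq_bigr => j _.
  by rewrite -{1}GT mxE [z _ * _]mulrC.
rewrite /GRing.scale /= big_distrr /= -big_split /=; apply: eq_bigr => i _.
rewrite big_distrr /= -big_split /=; apply: eq_bigr => j _.
by rewrite add_lfunE scale_lfunE /GRing.scale /=; ring.
Qed.

(** The basis dual to the z_{R_i} makes sum_ij G_ij f_i (x) f_j a form with Gram
    matrix G. *)
Lemma gram_surj (G : 'M[R]_n.+1) : G^T = G -> exists g, gram Rp g = G.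
Proof.
move=> GT; exists (SymBil (asboolT (form_of_subproof GT))).
apply/matrixP => k l; rewrite mxE /=.
rewrite (bigD1 k) //= [X in _ + X]big1 => [|i ik]; last first.
  by apply: big1 => j _; rewrite eval_atE bary_fun_vertex eq_sym (negbTE ik) mul0r mulr0.
rewrite (bigD1 l) //= [X in _ + X + _]big1 => [|j jl]; last first.
  by rewrite !eval_atE !bary_fun_vertex [l == j]eq_sym (negbTE jl) !mulr0.
by rewrite !eval_atE !bary_fun_vertex !eqxx !mulr1 !addr0.
Qed.

End Frame.

(** * The diagram and the coordinate rules *)

Theorem theorem3p8 (R : realType) (V : vectType R) (A : affineType V) (n : nat)
    (hn : \dim {:V} = n) :
  [/\ linear (@Theta R V A) /\ bijective (@Theta R V A),
      short_exact (cst_quad A) (@grad R V A) /\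
      short_exact (@tens_unit R V A) (@dd R V A),
      [/\ linear (cst_affine A) /\ injective (cst_affine A),
          linear (@aff_quad R V A) /\ injective (@aff_quad R V A),
          linear (@Hess R V A) & linear (@principal R V A)],
      [/\ forall c : R^o, cst_quad A c = aff_quad (cst_affine A c),
          forall f : affmap A R^o, Theta (tens_unit f) = aff_quad f,
          forall delta : quad A, Hess delta = principal (grad delta) &
          forall g : symbil 'Hom(affmap A R^o, R^o), Hess (Theta g) = dd g]
    & forall Rp : 'I_n.+1 -> A, affinely_independent Rp ->
        (forall G : 'M[R]_n.+1, G^T = G ->
           exists! g : symbil 'Hom(affmap A R^o, R^o), gram Rp g = G) /\
        forall (delta : quad A) (g : symbil 'Hom(affmap A R^o, R^o))
               (G : 'M[R]_n.+1),
          Theta g = delta -> gram Rp g = G ->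
          [/\ G^T = G,
              forall P : A,
                delta P = 2^-1 * g (eval_at P) (eval_at P) :> R /\
                forall p : 'cV[R]_n.+1, bary_coords Rp P p ->
                  delta P = 2^-1 * (p^T *m G *m p) 0 0 :> R,
              forall P Q : A,
                g (eval_at P) (eval_at Q)
                  = 4 * delta (midpoint P Q) - delta P - delta Q :> R /\
                forall p q : 'cV[R]_n.+1,
                  bary_coords Rp P p -> bary_coords Rp Q q ->
                  g (eval_at P) (eval_at Q) = (p^T *m G *m q) 0 0 :> R
            & forall i j : 'I_n.+1,
                G i j = g (eval_at (Rp i)) (eval_at (Rp j)) /\
                G i j = 4 * delta (midpoint (Rp i) (Rp j))
                        - delta (Rp i) - delta (Rp j)]].
Proof.
split.
- split; first exact: Theta_linear.
  by exists (@Theta_inv R V A); [exact: ThetaK | exact: Theta_invK].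
- split; split.
  + by move=> c x y; apply: quad_ext.
  + exact: grad_linear.
  + by move=> x y xy; have := congr1 (fun d : quad A => d (origin A)) xy.
  + exact: grad_eq0.
  + exact: grad_surj.
  + exact: tens_unit_linear.
  + exact: dd_linear.
  + exact: tens_unit_inj.
  + exact: dd_eq0.
  + by move=> h; exists (pull_form (origin A) h); exact: dd_pull_form.
- split.
  + split; first by move=> c x y; apply: affmap_ext.
    by move=> x y xy; have := congr1 (fun f : affmap A R^o => f (origin A)) xy.
  + split; last exact: aff_quad_inj.
    by move=> c f h; apply: quad_ext.
  + by move=> c d e; rewrite /Hess grad_linear principal_linear.
  + exact: principal_linear.
- split=> //.
  + by move=> c; apply: quad_ext.
  + exact: Theta_tens_unit.
  + exact: Hess_Theta.
move=> Rp indRp; split=> [G GT|delta g G <- <-].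
  have [g gG] := gram_surj indRp GT.
  by exists g; split=> // h hG; apply: (gram_inj hn indRp); rewrite gG hG.
split=> [|P|P Q|i j].
- exact: gram_sym.
- by split=> // p hp; rewrite ThetaE (gram_bary g hp hp).
- by split=> [|p q hp hq]; [exact: polarization | exact: gram_bary].
- by rewrite mxE -polarization.
Qed.
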